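(* Let $G$ be a finite abelian group with subgroups $G_1,\ldots,G_n$, and for each $i=1,\ldots,n$ let $\pi_i:G\to G/G_i$ be the canonical projection and let $\psi_i:G/G_i\to H_i$ be a group isomorphism onto an abelian group $H_i$. Then the quasi-uniform code corresponding to $G$ and $G_1,\ldots,G_n$ is defined over $H_1\times\cdots\times H_n$; that is, after relabeling the cosets of $G_i$ by elements of $H_i$ via $\psi_i$, it becomes $\{(\psi_1(\pi_1(g)),\ldots,\psi_n(\pi_n(g))) : g\in G\}\subseteq H_1\times\cdots\times H_n$, and this is a quasi-uniform code.
   Context: Let $n\ge1$ and $\mathcal{N}=\{1,\ldots,n\}$. A code of length $n$ is a nonempty subset $C$ of a product $\mathcal{X}_1\times\cdots\times\mathcal{X}_n$ of alphabets (finite sets, possibly different). Such a finite code induces random variables $X_1,\ldots,X_n$ by choosing a codeword $(X_1,\ldots,X_n)$ uniformly at random from $C$. For $\mathcal{A}\subseteq\mathcal{N}$, write $X_{\mathcal{A}}=(X_i)_{i\in\mathcal{A}}$ and let $\lambda(X_{\mathcal{A}})=\{x_{\mathcal{A}}: \Pr(X_{\mathcal{A}}=x_{\mathcal{A}})>0\}$ be its support. The code $C$ is quasi-uniform if for every $\mathcal{A}\subseteq\mathcal{N}$, $X_{\mathcal{A}}$ is uniformly distributed over $\lambda(X_{\mathcal{A}})$. For a finite group $G$ with subgroups $G_1,\ldots,G_n$, the corresponding quasi-uniform code is $\{(gG_1,\ldots,gG_n): g\in G\}$, where the $gG_i$ are left cosets. The canonical projection is $\pi_i(g)=gG_i$.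 *)

(* Defs.v *)
From mathcomp Require Import all_boot all_order all_algebra all_fingroup.
Set Implicit Arguments.
Unset Strict Implicit.
Unset Printing Implicit Defensive.

Import GRing.Theory Num.Theory.

Local Open Scope ring_scope.

Definition word n (X : 'I_n -> finType) := {dffun forall i : 'I_n, X i}.

Definition subword n (X : 'I_n -> finType) (A : {set 'I_n}) :=
  {dffun forall i : {j : 'I_n | j \in A}, X (val i)}.

Definition restrict n (X : 'I_n -> finType) (A : {set 'I_n}) (x : word X) :
    subword X A :=
  [ffun i : {j : 'I_n | j \in A} => x (val i)].

Definition uniform_pmf (T : finType) (S : {set T}) (x : T) : rat :=
  if x \in S then (#|S|%:R)^-1 else 0.

(* Pr (X_A = y), where (X_1, ..., X_n) is a uniformly random codeword of C. *)
Definition marginal n (X : 'I_n -> finType) (C : {set word X})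
    (A : {set 'I_n}) (y : subword X A) : rat :=
  \sum_(x : word X | restrict A x == y) uniform_pmf C x.

Definition msupport n (X : 'I_n -> finType) (C : {set word X})
    (A : {set 'I_n}) : {set subword X A} :=
  [set y : subword X A | 0 < marginal C y].

(* A code is by definition nonempty. *)
Definition quasi_uniform n (X : 'I_n -> finType) (C : {set word X}) : Prop :=
  C != set0 /\
  forall (A : {set 'I_n}) (y : subword X A),
    marginal C y = uniform_pmf (msupport C A) y.

Local Open Scope group_scope.

(* The code {(g G_1, ..., g G_n) : g in G}; its i-th letters are the left
   cosets of G_i in G, seen as subsets of gT. *)
Definition coset_code n (gT : finGroupType) (G : {group gT})
    (Gs : 'I_n -> {group gT}) : {set word (fun _ : 'I_n => {set gT} : finType)} :=
  [set [ffun i : 'I_n => g *: Gs i] | g in G].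

(* The relabelling of cosets induced by psi : G / K -> H.  A coset B of K,
   given as a subset of gT, is read as an element of the quotient type
   coset_of K, which is a subtype of {set gT}; the default value 1 is only used
   when B is not a coset of K in its normaliser.  When K is normal, its left
   and right cosets are the same subsets. *)
Definition coset_label (gT hT : finGroupType) (K : {group gT})
    (psi : coset_of K -> hT) (B : {set gT}) : hT :=
  psi (insubd (1 : coset_of K) B).

Definition relabel n (X Y : 'I_n -> finType) (f : forall i, X i -> Y i)
    (C : {set word X}) : {set word Y} :=
  [set ([ffun i : 'I_n => f i (x i)] : word Y) | x : word X in C].

(* Main.v *)
Require Import Defs.
From mathcomp Require Import all_boot all_order all_algebra all_fingroup.
Local Open Scope group_scope.

(** The code [D] is the image of [G] under the coordinatewise homomorphism
    [g |-> (psi_i (g G_i))_i], so right multiplication by a codeword permutes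
    [D], one coordinate at a time, and these translations act transitively on
    [D].  A coordinatewise bijection that preserves a code and takes [x1] to [x2]
    carries the codewords agreeing with [x1] on [A] to those agreeing with [x2]
    on [A]; hence all the values [X_A] can take are equally likely
    ([transitive_quasi_uniform]).

    For the relabelling, a left coset [g G_i] of the normal subgroup [G_i] is,
    as a subset of [G], the element [coset G_i g] of the quotient, so that
    [coset_label] reads it as [psi_i (coset G_i g)] ([coset_label_lcoset]). *)

Section Marginals.
Set Implicit Arguments.
Unset Strict Implicit.
Import Order.TTheory GRing.Theory Num.Theory.
Local Open Scope ring_scope.

Variables (n : nat) (X : 'I_n -> finType).
Implicit Types (C : {set word X}) (A : {set 'I_n}).

Lemma uniform_pmf_ge0 (T : finType) (S : {set T}) x : 0 <= uniform_pmf S x.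
Proof. by rewrite /uniform_pmf; case: ifP => // _; rewrite invr_ge0 ler0n. Qed.

Lemma sum_uniform_pmf (T : finType) (S : {set T}) :
  S != set0 -> \sum_x uniform_pmf S x = 1.
Proof.
rewrite -card_gt0 => S_gt0.
rewrite -big_mkcond sumr_const -[LHS]mulr_natl divff //.
by rewrite pnatr_eq0 -lt0n.
Qed.

Lemma marginal_ge0 C A (y : subword X A) : 0 <= marginal C y.
Proof. by apply: sumr_ge0 => x _; apply: uniform_pmf_ge0. Qed.

Lemma sum_marginal C A :
  C != set0 -> \sum_(y : subword X A) marginal C y = 1.
Proof.
move=> /sum_uniform_pmf <-.
by rewrite [RHS](partition_big (restrict A) xpredT).
Qed.

Lemma marginal_notin_msupport C A (y : subword X A) :
  y \notin msupport C A -> marginal C y = 0.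
Proof.
by rewrite inE -leNgt => y_le0; apply/eqP; rewrite eq_le y_le0 marginal_ge0.
Qed.

Lemma msupport_restrict C A (y : subword X A) :
  y \in msupport C A -> exists2 x, x \in C & y = restrict A x.
Proof.
rewrite inE => y_gt0.
have [/exists_inP[x xC /eqP <-]|/exists_inPn yC] :=
  boolP [exists x in C, restrict A x == y]; first by exists x.
move: y_gt0; rewrite /marginal big1 ?ltxx // => x xy.
by rewrite /uniform_pmf; case: ifP => // /yC; rewrite xy.
Qed.

(** Since the marginal probabilities sum to 1, they need only be equal to each
    other on the support. *)
Lemma constant_marginal_quasi_uniform C :
    C != set0 ->
    (forall A, {in C &, forall x1 x2,
       marginal C (restrict A x1) = marginal C (restrict A x2)}) ->
  quasi_uniform C.
Proof.
move=> C0 eq_marg; split=> // A y; rewrite /uniform_pmf.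
case: ifPn => [yS|]; last exact: marginal_notin_msupport.
have S0: #|msupport C A|%:R != 0 :> rat.
  by rewrite pnatr_eq0 -lt0n; apply/card_gt0P; exists y.
apply: (mulIf S0); rewrite mulVf // -[RHS](sum_marginal A C0).
rewrite [RHS](bigID (mem (msupport C A))) /= [X in _ + X]big1 ?addr0; last first.
  by move=> z; apply: marginal_notin_msupport.
have [x xC ->] := msupport_restrict yS.
rewrite (eq_bigr (fun=> marginal C (restrict A x))).
  by rewrite sumr_const mulr_natr.
by move=> z /msupport_restrict[x' x'C ->]; apply: eq_marg.
Qed.

(** The coordinatewise action of a family of letter maps on words. *)
Definition word_map (t : forall i, X i -> X i) (x : word X) : word X :=
  [ffun i => t i (x i)].

Lemma word_map_inj t : (forall i, injective (t i)) -> injective (word_map t).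
Proof.
move=> t_inj x y /ffunP eq_xy; apply/ffunP => i.
by have := eq_xy i; rewrite !ffunE => /t_inj.
Qed.

Lemma restrict_word_map t A x1 x2 :
    (forall i, injective (t i)) ->
  (restrict A (word_map t x1) == restrict A (word_map t x2)) =
  (restrict A x1 == restrict A x2).
Proof.
move=> t_inj; apply/eqP/eqP => /ffunP eq_x; apply/ffunP => i.
  by have := eq_x i; rewrite !ffunE => /t_inj.
by have := eq_x i; rewrite !ffunE => ->.
Qed.

(** A code on which coordinatewise permutations of the alphabets act
    transitively is quasi-uniform. *)
Lemma transitive_quasi_uniform C :
    C != set0 ->
    {in C &, forall x1 x2, exists t : forall i, X i -> X i,
      [/\ forall i, injective (t i), {in C, forall x, word_map t x \in C}
        & word_map t x1 = x2]} ->
  quasi_uniform C.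
Proof.
move=> C0 trC; apply: constant_marginal_quasi_uniform => // A x1 x2 x1C x2C.
have [t [t_inj tC <-]] := trC x1 x2 x1C x2C.
have tw_inj := word_map_inj t_inj.
(* An injection of the finite set C into itself is onto. *)
have tCE: word_map t @: C = C.
  apply/eqP; rewrite eqEcard card_imset // leqnn andbT.
  by apply/subsetP => _ /imsetP[x xC ->]; apply: tC.
rewrite /marginal [RHS](reindex_inj tw_inj) /=; apply: eq_big => [x|x _].
  by rewrite restrict_word_map.
by rewrite /uniform_pmf -{3}tCE mem_imset.
Qed.

End Marginals.

Lemma coset_label_lcoset (gT hT : finGroupType) (K : {group gT})
    (psi : coset_of K -> hT) (g : gT) :
  g \in 'N(K) -> coset_label psi (g *: K) = psi (coset K g).
Proof.
move=> nKg; congr psi; apply: val_inj.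
by rewrite /= -norm_rlcoset // -val_coset // valKd.
Qed.

Lemma coset_label_inj (gT hT : finGroupType) (G K : {group gT})
    (psi : {morphism G / K >-> hT}) :
    G \subset 'N(K) -> 'injm psi ->
  {in lcosets K G &, injective (coset_label psi)}.
Proof.
move=> /subsetP nKG inj_psi _ _ /lcosetsP[g gG ->] /lcosetsP[h hG ->].
have [nKg nKh] := (nKG g gG, nKG h hG).
rewrite !coset_label_lcoset // => /(injmP inj_psi) eq_gh.
rewrite -!norm_rlcoset // -!val_coset //.
by rewrite eq_gh // mem_quotient.
Qed.

Lemma coset_label_imset (gT hT : finGroupType) (G K : {group gT})
    (psi : {morphism G / K >-> hT}) :
  G \subset 'N(K) ->
  coset_label psi @: lcosets K G = psi @* (G / K).
Proof.
move=> nKG; have GK: G / K = coset K @: G by rewrite quotientE morphimEsub.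
rewrite morphimEdom; transitivity (psi @: (coset K @: G)); last by rewrite -GK.
rewrite /lcosets -!imset_comp; apply: eq_in_imset => g gG /=.
by rewrite lcosetE coset_label_lcoset // (subsetP nKG).
Qed.

Theorem proposition1 (n : nat) (n_gt0 : (0 < n)%N)
    (gT : finGroupType) (G : {group gT}) (abG : abelian G)
    (Gs : 'I_n -> {group gT}) (sGsG : forall i : 'I_n, Gs i \subset G)
    (hT : 'I_n -> finGroupType) (H : forall i : 'I_n, {group hT i})
    (abH : forall i : 'I_n, abelian (H i))
    (psi : forall i : 'I_n, {morphism G / Gs i >-> hT i})
    (psi_isom : forall i : 'I_n, isom (G / Gs i) (H i) (psi i)) :
  let Y : 'I_n -> finType := fun i => hT i in
  let label (i : 'I_n) : {set gT} -> Y i := coset_label (psi i) in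
  let D : {set word Y} :=
    [set ([ffun i : 'I_n => psi i (coset (Gs i) g) : Y i] : word Y) | g in G] in
  [/\ (* each label i is a one-to-one relabelling of the cosets of Gs i by H i *)
      forall i : 'I_n, {in lcosets (Gs i) G &, injective (label i)} /\
                       label i @: lcosets (Gs i) G = H i :> {set hT i},
      relabel label (coset_code G Gs) = D,
      D \subset setXn (fun i : 'I_n => H i : {set Y i})
    & quasi_uniform D].
Proof.
move=> Y label D.
have nG i: G \subset 'N(Gs i) by exact: sub_abelian_norm.
have psi_inj i: 'injm (psi i) by case/isomP: (psi_isom i).
have psi_im i: psi i @* (G / Gs i) = H i by case/isomP: (psi_isom i).
split.
- move=> i; split; first exact: coset_label_inj.
  by rewrite /label coset_label_imset.
- rewrite /relabel /coset_code -imset_comp; apply: eq_in_imset => g gG /=.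
  apply/ffunP => i; rewrite !ffunE.
  by rewrite /label coset_label_lcoset // (subsetP (nG i)).
- apply/subsetP => _ /imsetP[g gG ->]; apply/setXnP => i; rewrite ffunE.
  by rewrite -psi_im mem_morphim ?mem_quotient.
- pose phi g : word Y := [ffun i => psi i (coset (Gs i) g)].
  have phiM g h: g \in G -> h \in G ->
      word_map (fun i (a : hT i) => a * psi i (coset (Gs i) h)) (phi g)
      = phi (g * h).
    move=> gG hG; apply/ffunP => i; rewrite !ffunE.
    by rewrite -morphM ?mem_quotient // -morphM ?(subsetP (nG i)).
  apply: transitive_quasi_uniform.
    by apply/set0Pn; exists (phi 1); apply: imset_f.
  move=> _ _ /imsetP[g1 g1G ->] /imsetP[g2 g2G ->].
  have hG: g1^-1 * g2 \in G by rewrite groupM ?groupV.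
  exists (fun i (a : hT i) => a * psi i (coset (Gs i) (g1^-1 * g2))); split.
  + by move=> i; apply: mulIg.
  + move=> _ /imsetP[g gG ->].
    by rewrite phiM //; apply: imset_f; rewrite groupM.
  + by rewrite phiM // mulKVg.
Qed.
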